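(* Let $R$ be a commutative noetherian ring, let $\mathcal{S}_{Artin}$ be the subcategory of $R\text{-}\mathrm{Mod}$ consisting of Artinian $R$-modules, and let $\mathcal{S}$ be a Serre subcategory of $R\text{-}\mathrm{Mod}$. Then the subcategory $(\mathcal{S}, \mathcal{S}_{Artin})$ is a Serre subcategory of $R\text{-}\mathrm{Mod}$.
   Context: $R\text{-}\mathrm{Mod}$ denotes the category of all (unitary) $R$-modules. All full subcategories are assumed closed under isomorphisms. A Serre subcategory of an abelian category is a full subcategory closed under subobjects, quotient objects and extensions (in particular it contains the zero object). For Serre subcategories $\mathcal{S}_1, \mathcal{S}_2$ of $R\text{-}\mathrm{Mod}$, $(\mathcal{S}_1, \mathcal{S}_2)$ denotes the full subcategory of $R\text{-}\mathrm{Mod}$ consisting of all $R$-modules $M$ for which there exists a short exact sequence $0 \to S_1 \to M \to S_2 \to 0$ of $R$-modules with $S_1 \in \mathcal{S}_1$ and $S_2 \in \mathcal{S}_2$. *)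

(* Defs.v *)
From HB Require Import structures.
From mathcomp Require Import all_boot all_order all_algebra.
From mathcomp Require Import boolp classical_sets.

Set Implicit Arguments.
Unset Strict Implicit.
Unset Printing Implicit Defensive.

Import GRing.Theory.
Local Open Scope classical_set_scope.
Local Open Scope ring_scope.

(* The rings are [pzRingType]s, so that the zero ring is not excluded. *)

(* [N] is an arbitrary subset: membership in a [set] is the boolean given by
   classical logic, so decidability of [N] is not an assumption. *)
Definition submodule (R : pzRingType) (M : lmodType R) (N : set M) : Prop :=
  GRing.submod_closed [in N].

Definition artinian_module (R : pzRingType) (M : lmodType R) : Prop :=
  forall N : nat -> set M,
    (forall i, submodule (N i)) -> (forall i, N i.+1 `<=` N i) ->
    exists n, forall m, (n <= m)%N -> N m = N n.

Definition noetherian_module (R : pzRingType) (M : lmodType R) : Prop :=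
  forall N : nat -> set M,
    (forall i, submodule (N i)) -> (forall i, N i `<=` N i.+1) ->
    exists n, forall m, (n <= m)%N -> N m = N n.

(* The ideals of [R] are the submodules of the regular module [R^o]. *)
Definition noetherian_ring (R : comPzRingType) : Prop :=
  noetherian_module (R^o : lmodType R).

Definition short_exact (R : pzRingType) (A B C : lmodType R)
    (f : {linear A -> B}) (g : {linear B -> C}) : Prop :=
  [/\ injective f, forall y, g y = 0 <-> exists x, f x = y
    & forall z, exists y, g y = z].

(* A full subcategory of R-Mod is given by its class of objects. *)
Definition subcategory (R : pzRingType) : Type := lmodType R -> Prop.

Record serre_subcategory (R : pzRingType) (S : subcategory R) : Prop := {
  serre_iso : forall (M N : lmodType R) (f : {linear M -> N}),
    bijective f -> S M -> S N;
  serre_zero : forall M : lmodType R, (forall x : M, x = 0) -> S M;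
  serre_sub : forall (N M : lmodType R) (f : {linear N -> M}),
    injective f -> S M -> S N;
  serre_quotient : forall (M N : lmodType R) (g : {linear M -> N}),
    (forall z, exists y, g y = z) -> S M -> S N;
  serre_extension : forall (A B C : lmodType R)
    (f : {linear A -> B}) (g : {linear B -> C}),
    short_exact f g -> S A -> S C -> S B }.

Definition artinian_subcategory (R : pzRingType) : subcategory R :=
  fun M => artinian_module M.

Definition extension_subcategory (R : pzRingType) (S1 S2 : subcategory R) :
    subcategory R :=
  fun M => exists (A B : lmodType R) (f : {linear A -> M}) (g : {linear M -> B}),
    [/\ short_exact f g, S1 A & S2 B].

(* Main.v *)
Require Import Defs.
From HB Require Import structures.
From mathcomp Require Import all_boot all_order all_algebra.
From mathcomp Require Import boolp classical_sets.

Set Implicit Arguments.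
Unset Strict Implicit.
Unset Printing Implicit Defensive.

Import GRing.Theory.
Local Open Scope classical_set_scope.
Local Open Scope ring_scope.

(** A module [M] belongs to the subcategory of extensions of artinian modules
    by objects of [S] if and only if it has a submodule [K] that is in [S] and
    such that the submodules of [M] above [K] satisfy the descending chain
    condition ([extension_artinianP]).  In this form closure under submodules
    and quotients is a matter of preimages and images, and everything rests on
    closure under extensions.

    Let [X -> Y -> Z] be exact, with good submodules [KX] of [X] and [KZ] of
    [Z].  In [Y] modulo [KX], the submodule [X] is artinian, and one needs a
    submodule [N] of [Y] that meets [X] exactly in [KX] and has an artinian
    quotient ([dcc_complement]).  The intersection of [N] with the preimage of
    [KZ] is then the submodule sought for [Y]: it is an extension of a submodule
    of [KZ] by the image of [KX], and its quotient is still artinian because the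
    intersection of two submodules with artinian quotients has an artinian
    quotient ([dcc_setI]).

    To get [N], choose it with artinian quotient and with minimal intersection
    with [X].  If this intersection had an element [t] outside [KX], let [L] be
    maximal among the submodules that contain [KX] and avoid [t]; intersecting
    [N] with [L] would contradict minimality, provided that [M / L] is artinian.
    That is [dcc_maximal_avoiding], the place where the ring has to be
    commutative and noetherian.  It replaces the theorem of Matlis that the
    injective hull of a simple module is artinian: [M / L] is an essential
    extension of the simple module generated by [t].  Let [J] be the annihilator
    of [t] modulo [L].  Every element of [J] acts locally nilpotently on [M / L]
    ([maximal_avoiding_torsion]), and the part of [M / L] killed by [J] is the
    simple module generated by [t].  Finally, if [x] acts locally nilpotently,
    the descending chain condition passes from the part killed by [x] to the
    whole module ([dcc_torsion]), and as [J] is finitely generated, finitely many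
    such steps lead from [J] to [0]. *)

(** * Submodules as subsets *)

Section Submodules.
Variables (R : pzRingType) (M : lmodType R).
Implicit Types (K N : set M) (x y : M).

Lemma submoduleP N :
  submodule N <-> N 0 /\ forall a x y, N x -> N y -> N (a *: x + y).
Proof.
split=> [[N0 NL] | [N0 NL]]; split.
- exact: set_mem N0.
- by move=> a x y Nx Ny; apply: set_mem; apply: NL; apply: mem_set.
- exact: mem_set.
- by move=> a x y /set_mem Nx /set_mem Ny; apply: mem_set; apply: NL.
Qed.

Lemma submodule0 N : submodule N -> N 0.
Proof. by case/submoduleP. Qed.

Lemma submoduleZ N a x : submodule N -> N x -> N (a *: x).
Proof.
by case/submoduleP=> N0 NL Nx; rewrite -[a *: x]addr0; exact: NL.
Qed.

Lemma submoduleD N x y : submodule N -> N x -> N y -> N (x + y).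
Proof. by case/submoduleP=> _ NL Nx Ny; rewrite -[x]scale1r; exact: NL. Qed.

Lemma submoduleB N x y : submodule N -> N x -> N y -> N (x - y).
Proof.
by move=> hN Nx Ny; rewrite -scaleN1r; apply: submoduleD (submoduleZ _ _ _).
Qed.

Lemma submoduleBr N x y : submodule N -> N y -> N (x - y) -> N x.
Proof. by move=> hN Ny Nxy; rewrite -[x](subrK y); exact: submoduleD. Qed.

Lemma submodule_setT : submodule (setT : set M).
Proof. exact/submoduleP. Qed.

Lemma submodule_set0 : submodule [set (0 : M)].
Proof. by apply/submoduleP; split=> // a x y -> ->; rewrite scaler0 addr0. Qed.

Lemma submodule_setI K N : submodule K -> submodule N -> submodule (K `&` N).
Proof.
move=> /submoduleP[K0 KL] /submoduleP[N0 NL]; apply/submoduleP.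
by split=> // a x y [? ?] [? ?]; split; [apply: KL | apply: NL].
Qed.

Definition sumset K N : set M :=
  [set x | exists2 k, K k & exists2 n, N n & x = k + n].

Lemma submodule_sumset K N : submodule K -> submodule N ->
  submodule (sumset K N).
Proof.
move=> /submoduleP[K0 KL] /submoduleP[N0 NL]; apply/submoduleP; split.
  by exists 0 => //; exists 0; rewrite ?addr0.
move=> a _ _ [k Kk [n Nn ->]] [k' Kk' [n' Nn' ->]].
exists (a *: k + k'); first exact: KL.
by exists (a *: n + n'); [exact: NL | rewrite scalerDr addrACA].
Qed.

Lemma sumset_subl K N : N 0 -> K `<=` sumset K N.
Proof. by move=> N0 k Kk; exists k => //; exists 0; rewrite ?addr0. Qed.

Lemma sumset_subr K N : K 0 -> N `<=` sumset K N.
Proof. by move=> K0 n Nn; exists 0 => //; exists n; rewrite ?add0r. Qed.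

Lemma sumset_sub K N P : submodule P -> K `<=` P -> N `<=` P ->
  sumset K N `<=` P.
Proof.
by move=> hP KP NP _ [k /KP Pk [n /NP Pn ->]]; exact: submoduleD.
Qed.

Lemma sumsetS K N N' : N `<=` N' -> sumset K N `<=` sumset K N'.
Proof.
by move=> NN' _ [k Kk [n Nn ->]]; exists k => //; exists n => //; exact: NN'.
Qed.

Definition cyclic x : set M := range (fun r : R => r *: x).

Lemma submodule_cyclic x : submodule (cyclic x).
Proof.
apply/submoduleP; split; first by exists 0; rewrite ?scale0r.
move=> a _ _ [r _ <-] [s _ <-]; exists (a * r + s) => //.
by rewrite scalerDl scalerA.
Qed.

Lemma cyclic_gen x : cyclic x x.
Proof. by exists 1; rewrite ?scale1r. Qed.

End Submodules.

Section LinearMaps.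
Variables (R : pzRingType) (M M' : lmodType R) (h : {linear M -> M'}).

Lemma submodule_image (N : set M) : submodule N -> submodule (h @` N).
Proof.
move=> /submoduleP[N0 NL]; apply/submoduleP; split.
  by exists 0; rewrite ?linear0.
move=> a _ _ [x Nx <-] [y Ny <-]; exists (a *: x + y); first exact: NL.
by rewrite linearP.
Qed.

Lemma submodule_preimage (N : set M') : submodule N -> submodule (h @^-1` N).
Proof.
move=> /submoduleP[N0 NL]; apply/submoduleP; split=> /=.
  by rewrite /= linear0.
by move=> a x y /= Nx Ny; rewrite linearP; exact: NL.
Qed.

Lemma submodule_range : submodule (range h).
Proof. exact/submodule_image/submodule_setT. Qed.

End LinearMaps.

(** * Submodules and quotients as modules *)

Section SubmoduleType.
Variables (R : pzRingType) (M : lmodType R) (N : set M) (hN : submodule N).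

(** The proof that [N] is a submodule is an argument of the type, so that the
    module structure can be inferred from the type. *)
Definition submodule_type of submodule N := {x : M | x \in N}.

HB.instance Definition _ := SubChoice.on (submodule_type hN).
HB.instance Definition _ :=
  GRing.SubChoice_isSubLmodule.Build R M [in N] (submodule_type hN)
    (GRing.submod_closed_semi hN).

End SubmoduleType.

Section QuotientType.
Local Open Scope quotient_scope.
Variables (R : pzRingType) (M : lmodType R) (N : set M) (hN : submodule N).

(** A copy of the membership predicate that carries the proof of closure, which
    the quotient of additive groups infers from it. *)
Definition zmod_pred of submodule N : {pred M} := [in N].
HB.instance Definition _ :=
  GRing.isZmodClosed.Build M (zmod_pred hN) (GRing.submod_closedB hN).

Definition quotient_module := Quotient.quot (zmod_pred hN).
HB.instance Definition _ := ZmodQuotient.on quotient_module.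
Local Notation Q := quotient_module.

Lemma piQ_eq x y : \pi_Q x = \pi_Q y <-> N (x - y).
Proof.
split=> [/eqP | Nxy].
  by rewrite -Quotient.idealrBE => /set_mem.
by apply/eqP; rewrite -Quotient.idealrBE; exact: mem_set.
Qed.

Definition quotient_scale (a : R) (q : Q) : Q := \pi_Q (a *: repr q).

Lemma quotient_scaleE a x : quotient_scale a (\pi_Q x) = \pi_Q (a *: x).
Proof.
apply/piQ_eq; rewrite -scalerBr; apply: submoduleZ => //.
by apply/piQ_eq; rewrite reprK.
Qed.

Lemma piQD : {morph \pi_Q : x y / x + y}.
Proof. by move=> x y; rewrite raddfD. Qed.

Fact quotient_scalerA a b q :
  quotient_scale a (quotient_scale b q) = quotient_scale (a * b) q.
Proof. by rewrite -[q]reprK (quotient_scaleE b) !quotient_scaleE scalerA. Qed.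

Fact quotient_scale1r : left_id 1 quotient_scale.
Proof. by move=> q; rewrite -[q]reprK quotient_scaleE scale1r. Qed.

Fact quotient_scalerDr : right_distributive quotient_scale +%R.
Proof.
move=> a p q; rewrite -[p]reprK -[q]reprK -piQD !quotient_scaleE -piQD.
by rewrite scalerDr.
Qed.

Fact quotient_scalerDl q : {morph quotient_scale^~ q : a b / a + b}.
Proof.
by move=> a b /=; rewrite -[q]reprK !quotient_scaleE scalerDl piQD.
Qed.

HB.instance Definition _ := GRing.Zmodule_isLmodule.Build R Q
  quotient_scalerA quotient_scale1r quotient_scalerDr quotient_scalerDl.

Definition quotient_map (x : M) : Q := \pi_Q x.

Fact quotient_map_linear : linear quotient_map.
Proof.
by move=> a x y; rewrite /quotient_map piQD -quotient_scaleE.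
Qed.
HB.instance Definition _ :=
  GRing.isLinear.Build R M Q _ quotient_map quotient_map_linear.

End QuotientType.

Lemma exists_submodule_object (R : pzRingType) (M : lmodType R) (N : set M) :
  submodule N ->
  exists (A : lmodType R) (f : {linear A -> M}), injective f /\ range f = N.
Proof.
move=> hN; exists (submodule_type hN : lmodType R).
exists (val : {linear submodule_type hN -> M}); split; first exact: val_inj.
apply/seteqP; split=> [_ [x _ <-] | x Nx]; first exact: set_mem (valP x).
by exists (Sub x (mem_set Nx) : submodule_type hN); rewrite ?SubK.
Qed.

Lemma exists_quotient_object (R : pzRingType) (M : lmodType R) (N : set M) :
  submodule N ->
  exists (B : lmodType R) (g : {linear M -> B}),
    (forall z, exists y, g y = z) /\ forall y, g y = 0 <-> N y.
Proof.
move=> hN; exists (quotient_module hN : lmodType R).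
exists (@quotient_map R M N hN : {linear M -> quotient_module hN}); split.
  by move=> z; exists (repr z); rewrite /= /quotient_map reprK.
move=> y; rewrite -[X in _ = X](linear0 (@quotient_map R M N hN)).
by rewrite -[y in N y]subr0; exact: piQ_eq.
Qed.

Lemma linear_factor (R : pzRingType) (X A M : lmodType R)
    (u : {linear X -> M}) (f : {linear A -> M}) :
  injective f -> range u `<=` range f ->
  exists v : {linear X -> A}, forall x, f (v x) = u x.
Proof.
move=> f_inj uf.
have /choice[v fv] : forall x, exists a, f a = u x.
  by move=> x; have [|a _ <-] := uf (u x); [exists x | exists a].
have v_lin : linear v.
  by move=> a x y; apply: f_inj; rewrite linearP !fv linearP.
pose vL : {linear X -> A} :=
  HB.pack v (GRing.isLinear.Build R X A _ v v_lin).
by exists vL.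
Qed.


(** * The descending chain condition on an interval of submodules *)

Section ChainCondition.
Variable R : pzRingType.
Implicit Types M : lmodType R.

(** Dependent choice turns a chain condition into the existence of an extremal
    element; [lt y z] reads as: [z] improves on [y]. *)
Lemma exists_extremal (T : Type) (lt : T -> T -> Prop) (P : T -> Prop) :
  (forall u : nat -> T, (forall n, P (u n)) -> ~ forall n, lt (u n) (u n.+1)) ->
  forall x, P x -> exists y, P y /\ forall z, P z -> ~ lt y z.
Proof.
move=> noseq x Px; apply: contrapT => /forallNP noext.
have next (y : {y | P y}) : {z : {z | P z} | lt (sval y) (sval z)}.
  apply: cid; apply: contrapT => noz; apply: (noext (sval y)).
  split; first exact: (svalP y).
  by move=> z Pz yz; apply: noz; exists (exist P z Pz).
have [u [_ u_lt]] := dependent_choice next (exist P x Px).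
by apply: (noseq (sval \o u)) => // n; exact: (svalP (u n)).
Qed.

(** The module [N / K] is artinian, expressed without forming the quotient. *)
Definition dcc_interval M (K N : set M) := forall u : nat -> set M,
  (forall i, submodule (u i)) -> (forall i, K `<=` u i) ->
  (forall i, u i `<=` N) -> (forall i, u i.+1 `<=` u i) ->
  exists n, forall m, (n <= m)%N -> u m = u n.

Lemma chain_decr (T : Type) (u : nat -> set T) :
  (forall i, u i.+1 `<=` u i) -> forall i j, (i <= j)%N -> u j `<=` u i.
Proof.
move=> u_decr i j /subnK <-; elim: (j - i)%N => [|k IH]; first by rewrite add0n.
by rewrite addSn; apply: subset_trans (u_decr _) IH.
Qed.

(** A chain stabilises as soon as its image under a monotone map [F] does and
    [F] is injective on comparable submodules. *)
Lemma dcc_transfer M M' (K N : set M) (K' N' : set M')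
    (F : set M' -> set M) :
  dcc_interval K N ->
  (forall U, submodule U -> K' `<=` U -> U `<=` N' ->
     [/\ submodule (F U), K `<=` F U & F U `<=` N]) ->
  (forall U V, U `<=` V -> F U `<=` F V) ->
  (forall U V, submodule U -> K' `<=` U -> submodule V -> V `<=` N' ->
     U `<=` V -> F U = F V -> V `<=` U) ->
  dcc_interval K' N'.
Proof.
move=> dccKN FKN F_mono F_inj u u_sub Ku uN u_decr.
have FuP i := FKN (u i) (u_sub i) (Ku i) (uN i).
have [|i|i|i|n nP] := dccKN (F \o u).
- by move=> i; case: (FuP i).
- by case: (FuP i).
- by case: (FuP i).
- exact/F_mono/u_decr.
exists n => m nm; have umn := chain_decr u_decr nm.
by apply/seteqP; split=> //; apply: F_inj => //; exact: nP.
Qed.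

(** The quotient of [M] by the preimage of [K] embeds in [M' / K]. *)
Lemma dcc_preimage M M' (h : {linear M -> M'}) (K : set M') :
  submodule K -> dcc_interval K setT -> dcc_interval (h @^-1` K) setT.
Proof.
move=> hK dccK.
apply: (@dcc_transfer _ _ _ _ _ _ (fun U => sumset K (h @` U)) dccK).
- move=> U hU _ _; split=> //.
    by apply: submodule_sumset => //; exact: submodule_image.
  exact: sumset_subl (submodule0 (submodule_image h hU)).
- by move=> U V UV; apply: sumsetS; exact: image_subset.
move=> U V hU KU hV _ UV eqUV x Vx.
have : sumset K (h @` V) (h x).
  by apply: sumset_subr; [exact: submodule0 | exists x].
rewrite -eqUV => -[k Kk [_ [y Uy <-] hxE]].
apply: submoduleBr Uy _ => //; apply: KU.
by rewrite /= linearB hxE addrK.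
Qed.

(** The quotient of the range by the image of [K] is a quotient of [M / K]. *)
Lemma dcc_image M M' (h : {linear M -> M'}) (K : set M) :
  dcc_interval K setT -> dcc_interval (h @` K) (range h).
Proof.
move=> dccK.
apply: (@dcc_transfer _ _ _ _ _ _ (fun U => h @^-1` U) dccK).
- move=> U hU KU _; split=> //; first exact: submodule_preimage.
  by move=> x Kx; apply: KU; exists x.
- by move=> U V UV x /= /UV.
move=> U V _ _ _ Vh _ eqUV y Vy; have [x _ hxy] := Vh _ Vy.
rewrite -hxy; suff : (h @^-1` U) x by [].
by rewrite eqUV /= hxy.
Qed.

(** [M / (K `&` L)] embeds in the direct sum of [M / K] and [M / L].  A chain
    [u] above [K `&` L] is recovered from the chains [K + u] and
    [L + (K `&` u)]: the first controls [u] modulo [K], the second controls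
    [K `&` u] modulo [L]. *)
Lemma dcc_setI M (K L : set M) : submodule K -> submodule L ->
  dcc_interval K setT -> dcc_interval L setT -> dcc_interval (K `&` L) setT.
Proof.
move=> hK hL dccK dccL u u_sub KLu _ u_decr.
have [|i|//|i|n nP] := dccK (fun i => sumset K (u i)).
- by move=> i; exact: submodule_sumset.
- exact: sumset_subl (submodule0 (u_sub i)).
- exact: sumsetS.
have [|i|//|i|n' nP'] := dccL (fun i => sumset L (K `&` u i)).
- by move=> i; apply: submodule_sumset => //; exact: submodule_setI.
- exact: sumset_subl (submodule0 (submodule_setI hK (u_sub i))).
- by apply: sumsetS; apply: setIS; exact: u_decr.
exists (maxn n n') => m le_m; have um := chain_decr u_decr le_m.
apply/seteqP; split=> // x ux; set p := maxn n n' in le_m um ux.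
have le_n : (n <= p)%N := leq_maxl _ _.
have le_n' : (n' <= p)%N := leq_maxr _ _.
have : sumset K (u p) x by exact: sumset_subr (submodule0 hK) _ ux.
rewrite (nP _ le_n) -(nP _ (leq_trans le_n le_m)) => -[k Kk [y umy xE]].
have : sumset L (K `&` u p) k.
  apply: sumset_subr (submodule0 hL) _ _; split=> //.
  by rewrite -[k](addrK y) -xE; apply: submoduleB => //; exact: um.
rewrite (nP' _ le_n') -(nP' _ (leq_trans le_n' le_m)).
move=> -[l Ll [z [Kz umz] kE]].
rewrite xE; apply: submoduleD => //; rewrite kE; apply: submoduleD => //.
apply: KLu; split=> //; rewrite -[l](addrK z) -kE; exact: submoduleB.
Qed.

Lemma artinian_dcc M : artinian_module M -> dcc_interval [set (0 : M)] setT.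
Proof. by move=> artM u u_sub _ _; exact: artM. Qed.

Lemma dcc_artinian M : dcc_interval [set (0 : M)] setT -> artinian_module M.
Proof.
move=> dccM u u_sub u_decr; apply: dccM => // i _ ->.
exact: submodule0.
Qed.

End ChainCondition.

(** * Maximal submodules avoiding an element *)

Section NoetherianRing.
Variables (R : comPzRingType) (M : lmodType R).
Implicit Types (K L N U X : set M) (x y r s : R) (m t : M).

Lemma scale_submodule x U : submodule U ->
  submodule [set x *: m | m in U].
Proof.
move=> /submoduleP[U0 UL]; apply/submoduleP; split.
  by exists 0; rewrite ?scaler0.
move=> a _ _ [m Um <-] [m' Um' <-]; exists (a *: m + m'); first exact: UL.
by rewrite scalerDr !scalerA mulrC.
Qed.

Definition colon L (I : set R) : set M :=
  [set m | forall x, I x -> L (x *: m)].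

Lemma submodule_colon L I : submodule L -> submodule (colon L I).
Proof.
move=> /submoduleP[L0 LL]; apply/submoduleP; split=> [x _|a m m' Lm Lm' x Ix].
  by rewrite scaler0.
by rewrite scalerDr scalerA mulrC -scalerA; apply: LL; [apply: Lm|apply: Lm'].
Qed.

Lemma subset_colon L I : submodule L -> L `<=` colon L I.
Proof. by move=> hL m Lm x _; exact: submoduleZ. Qed.

(** In a doubly decreasing family the diagonal [Q i i] becomes constant at some
    [d], and then so does every [Q i j] with [d <= i] and [d <= j].  Each of the
    finitely many rows with [i < d] stabilises separately, whence a bound that
    is uniform in [i]. *)
Lemma dcc_double K N (Q : nat -> nat -> set M) :
  dcc_interval K N ->
  (forall i j, submodule (Q i j)) -> (forall i j, K `<=` Q i j) ->
  (forall i j, Q i j `<=` N) ->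
  (forall i j, Q i.+1 j `<=` Q i j) -> (forall i j, Q i j.+1 `<=` Q i j) ->
  exists k, forall i j, (k <= j)%N -> Q i j = Q i k.
Proof.
move=> dccKN Q_sub KQ QN Q_decr1 Q_decr2.
have QS i i' j j' : (i <= i')%N -> (j <= j')%N -> Q i' j' `<=` Q i j.
  move=> ii' jj'; apply: (subset_trans (chain_decr (Q_decr2 i') jj')).
  exact: (chain_decr (fun i => Q_decr1 i j) ii').
have [//|//|//|i|d dP] := dccKN (fun i => Q i i); first exact: QS.
have /choice[c cP] i : exists c, forall j, (c <= j)%N -> Q i j = Q i c.
  by apply: dccKN.
pose k := maxn d (\max_(i < d) c i).
have dk : (d <= k)%N by exact: leq_maxl.
exists k => i j kj; have [lt_id | le_di] := ltnP i d.
  have ck : (c i <= k)%N.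
    apply: leq_trans (leq_maxr _ _).
    exact: (leq_bigmax (F := fun i : 'I_d => c i) (Ordinal lt_id)).
  by rewrite (cP i j (leq_trans ck kj)) (cP i k ck).
have Qd e : (k <= e)%N -> Q i e = Q d d.
  move=> ke; have de := leq_trans dk ke; apply/seteqP; split; first exact: QS.
  rewrite -(dP (maxn i e)) ?leq_max ?le_di //.
  by apply: QS; [exact: leq_maxl | exact: leq_maxr].
by rewrite !Qd.
Qed.

(** If [x] acts locally nilpotently on [N / L], a submodule [U] above [L] is
    determined, among the submodules of a given one, by the parts of the
    [L + x ^+ i U] that are killed by [x] modulo [L].  For a decreasing chain
    these parts decrease with [i] and along the chain, so that [dcc_double]
    applies. *)
Lemma dcc_torsion L N x : submodule L -> submodule N -> L `<=` N ->
  (forall m, N m -> exists n, L (x ^+ n *: m)) ->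
  dcc_interval L (N `&` [set m | L (x *: m)]) -> dcc_interval L N.
Proof.
move=> hL hN LN xtors dccLx u u_sub Lu uN u_decr.
pose Q i j := sumset L [set x ^+ i *: m | m in u j] `&` [set m | L (x *: m)].
have [i j|i j m Lm|i j m [Qm Lxm]|i j m [Qm Lxm]|i j m [Qm Lxm]|k kP] :=
  dcc_double (Q := Q) dccLx.
- apply: submodule_setI.
    by apply: submodule_sumset => //; exact: scale_submodule.
  have := submodule_colon [set x] hL; congr submodule; apply/seteqP.
  by split=> m /=; [exact | move=> Lxm y ->].
- split; last exact: submoduleZ.
  apply: sumset_subl Lm; exact: submodule0 (scale_submodule _ (u_sub j)).
- split=> //; apply: sumset_sub Qm => //.
  by move=> _ [m' um' <-]; apply: submoduleZ => //; exact: uN um'.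
- split=> //; apply: sumsetS Qm => _ [m' um' <-].
  by exists (x *: m'); [exact: submoduleZ | rewrite scalerA -exprSr].
- split=> //; apply: sumsetS Qm => _ [m' um' <-].
  by exists m' => //; exact: u_decr.
exists k => j kj; apply/seteqP; split; first exact: chain_decr kj.
suff uP n m : u k m -> L (x ^+ n *: m) -> u j m.
  by move=> m ukm; have [n] := xtors m (uN _ _ ukm); exact: uP.
(* An element killed by [x ^+ n.+1] is moved into [u j] up to an element that
   is killed by [x ^+ n]. *)
elim: n m => [|n IH] m ukm; first by rewrite expr0 scale1r => /Lu.
rewrite exprS -scalerA => Lxm.
have : Q n k (x ^+ n *: m).
  by split=> //; apply: sumset_subr; [exact: submodule0 | exists m].
rewrite -(kP n j kj) => -[[l Ll [_ [m' um' <-] mE]] _].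
apply: (submoduleBr _ um') => //; apply: IH.
  by apply: submoduleB => //; exact: chain_decr um'.
by rewrite scalerBr mE addrK.
Qed.

Definition maximal_avoiding t L :=
  [/\ submodule L, ~ L t &
      forall N, submodule N -> L `<=` N -> ~ N t -> N `<=` L].

Lemma exists_maximal_avoiding K t : submodule K -> ~ K t ->
  exists2 L, maximal_avoiding t L & K `<=` L.
Proof.
move=> hK nKt.
(* Zorn is applied to sets whose union with [K] is a submodule, because the
   union of the empty chain is empty. *)
pose P X := submodule (X `|` K) /\ ~ (X `|` K) t.
have [|A [[hA nAt] A_max]] := @Zorn_bigcup M P.
  move=> F FP F_tot; split; last first.
    by move=> [[X FX Xt]|//]; have [_ []] := FP _ FX; left.
  apply/submoduleP; split=> [|a x y]; first by right; exact: submodule0.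
  have in_one X : F X -> (X `|` K) x -> (X `|` K) y ->
      ((\bigcup_(X in F) X) `|` K) (a *: x + y).
    move=> FX Xx Xy; have [/submoduleP[_ XL] _] := FP _ FX.
    by case: (XL a x y Xx Xy); [left; exists X | right].
  move=> [[X FX Xx]|Kx] [[Y FY Yy]|Ky].
  - have [XY|YX] := F_tot _ _ FX FY.
      by apply: (in_one Y) => //; left => //; exact: XY.
    by apply: (in_one X) => //; left => //; exact: YX.
  - by apply: (in_one X) => //; [left | right].
  - by apply: (in_one Y) => //; [right | left].
  - right; apply: submoduleD => //; exact: submoduleZ.
exists (A `|` K); last by right.
split=> // N hN AKN nNt m Nm; left; apply: contrapT => nAm.
have NK : N `|` K = N by apply/setUidPl => y Ky; apply: AKN; right.
apply: (A_max N); last by rewrite /P NK.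
split; first by move=> y Ay; apply: AKN; left.
by move=> /(_ _ Nm).
Qed.

Section MaximalAvoiding.
Variables (t : M) (L : set M).
Hypothesis Lmax : maximal_avoiding t L.

(** Modulo [L], every nonzero submodule contains [t]. *)
Lemma maximal_avoiding_gen m : ~ L m -> exists r, L (t - r *: m).
Proof.
have [hL nLt Lt_max] := Lmax; move=> nLm; apply: contrapT => nor.
have hN : submodule (sumset L (cyclic m)).
  exact: submodule_sumset (submodule_cyclic _).
apply: nLm; apply: (Lt_max _ hN).
- exact: sumset_subl (submodule0 (submodule_cyclic m)).
- move=> [l Ll [_ [r _ <-] tE]]; apply: nor; exists r.
  by rewrite tE addrK.
- exact: sumset_subr (submodule0 hL) _ (cyclic_gen m).
Qed.

Hypothesis R_noeth : noetherian_ring R.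

(** For [n] large enough [x] is injective, modulo [L], on the submodule generated
    by [x ^+ n *: m], because the annihilators of the [x ^+ n *: m] modulo
    [L] form an ascending chain of ideals.  Were this submodule nonzero it would
    contain [t], which [x] kills. *)
Lemma maximal_avoiding_torsion x m : L (x *: t) -> exists n, L (x ^+ n *: m).
Proof.
have [hL nLt _] := Lmax; move=> Lxt.
pose I n : set R^o := [set r : R^o | L (x ^+ n *: ((r : R) *: m))].
have [i|i r Lr|n nP] := R_noeth (N := I).
- apply/submoduleP; split=> [|a r s Lr Ls].
    by rewrite /I /= scale0r scaler0; exact: submodule0.
  rewrite /I /= scalerDl scalerDr; apply: submoduleD => //.
  rewrite -[a *: r]/(a * r) -scalerA scalerA mulrC -scalerA.
  exact: submoduleZ.
- by rewrite /I /= exprS -scalerA; exact: submoduleZ.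
exists n; apply: contrapT => /maximal_avoiding_gen[r Lr].
have LI : I n.+1 r.
  have := submoduleB hL Lxt (submoduleZ x hL Lr).
  rewrite scalerBr opprB addrC subrK /I /= exprS !scalerA.
  by rewrite mulrA [x * r * _]mulrAC.
apply: nLt; apply: submoduleBr Lr => //.
move: LI; rewrite (nP _ (leqnSn n)) /I /=.
by rewrite !scalerA mulrC.
Qed.

(** Among the ideals [I] that annihilate [t] modulo [L], and for which the chain
    condition on the part killed by [I] implies the chain condition on [M / L],
    choose a maximal one.  By [dcc_torsion] any [x] that kills [t] can be
    adjoined to [I], so [I] is the whole annihilator of [t].  The part killed by
    [I] is then simple. *)
Lemma dcc_maximal_avoiding : dcc_interval L setT.
Proof.
have [hL nLt Lt_max] := Lmax.
pose P (I : set R^o) := [/\ submodule I, forall x, I x -> L ((x : R) *: t) &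
  dcc_interval L (colon L I) -> dcc_interval L setT].
pose lt (I I' : set R^o) := I `<=` I' /\ ~ (I' `<=` I).
have [u uP u_lt||I [[hI It dccI] I_max]] :=
    @exists_extremal _ lt P _ [set 0].
- have [i|i|n nP] := R_noeth (N := u); first by case: (uP i).
    by case: (u_lt i).
  by have [_ []] := u_lt n; rewrite (nP n.+1).
- split; [exact: submodule_set0 | |].
    by move=> x ->; rewrite scale0r; exact: submodule0.
  suff -> : colon L [set 0] = setT by [].
  apply/seteqP; split=> // m _ x ->; rewrite scale0r; exact: submodule0.
have It_max x : L (x *: t) -> I x.
  move=> Lxt; apply: contrapT => nIx.
  pose I' : set R^o := sumset I (cyclic (x : R^o)).
  have II' : I `<=` I' by exact: sumset_subl (submodule0 (submodule_cyclic _)).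
  have I'x : I' x by exact: sumset_subr (submodule0 hI) _ (cyclic_gen _).
  apply: (I_max I'); last by split=> // /(_ _ I'x).
  split; first exact: submodule_sumset (submodule_cyclic _).
    move=> _ [y Iy [_ [r _ <-] ->]]; rewrite scalerDl.
    apply: submoduleD => //; first exact: It.
    by rewrite -[r *: _]/(r * x) -scalerA; exact: submoduleZ.
  move=> dccI'; apply: dccI; apply: (@dcc_torsion _ _ x) => //.
  - exact: submodule_colon.
  - exact: subset_colon.
  - by move=> m _; exact: maximal_avoiding_torsion.
  suff <- : colon L I' = colon L I `&` [set m | L (x *: m)] by [].
  apply/seteqP; split=> m.
    by move=> I'm; split=> [y /II'/I'm|] //; exact: I'm.
  move=> [Im Lxm] _ [y Iy [_ [r _ <-] ->]]; rewrite scalerDl.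
  apply: submoduleD => //; first exact: Im.
  by rewrite -[r *: _]/(r * x) -scalerA; exact: submoduleZ.
apply: dccI => u u_sub Lu uI u_decr.
have [[n nut] | allt] := pselect (exists n, ~ u n t).
  have uL : u n = L by apply/seteqP; split=> //; exact: Lt_max.
  exists n => m nm; apply/seteqP; split; first exact: chain_decr nm.
  by rewrite uL.
(* Modulo [L]: if [t = r *: m], then [r] does not kill [t], for otherwise [r]
   would be in [I] and kill [m].  Hence some [s * r] fixes [t], so it acts as the identity
   on everything killed by [I], and [m = s *: t]. *)
have uE i : u i = colon L I.
  apply/seteqP; split=> // m Im.
  have ut : u i t by apply: contrapT => nut; apply: allt; exists i.
  have [/Lu // | nLm] := pselect (L m).
  have [r Lr] := maximal_avoiding_gen nLm.
  have nLrt : ~ L (r *: t).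
    by move=> /It_max/Im Lrm; apply: nLt; exact: submoduleBr Lrm Lr.
  have [s Ls] := maximal_avoiding_gen nLrt.
  have I1 : I (1 - s * r) by apply: It_max; rewrite scalerBl scale1r -scalerA.
  have urm : u i (s *: (r *: m)).
    apply: submoduleZ => //; rewrite -[r *: m](subKr t).
    by apply: submoduleB => //; exact: Lu.
  apply: submoduleBr urm _ => //; apply: Lu.
  by have := Im _ I1; rewrite scalerBl scale1r -scalerA.
by exists 0%N => m _; rewrite !uE.
Qed.

End MaximalAvoiding.

(** An artinian submodule [X / K] of [M / K] is separated from zero by a single
    artinian quotient [M / N].  This holds because [N] can be chosen with
    [N `&` X] minimal. *)
Lemma dcc_complement K X : noetherian_ring R ->
  submodule K -> submodule X -> K `<=` X -> dcc_interval K X ->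
  exists N, [/\ submodule N, K `<=` N, N `&` X `<=` K & dcc_interval N setT].
Proof.
move=> R_noeth hK hX KX dccKX.
pose P N := [/\ submodule N, K `<=` N & dcc_interval N setT].
pose lt N N' := N' `&` X `<=` N `&` X /\ ~ (N `&` X `<=` N' `&` X).
have [u uP u_lt||N [[hN KN dccN] N_min]] := @exists_extremal _ lt P _ setT.
- have [i|i m Km|i|i|n nP] := dccKX (fun i => u i `&` X).
  + by apply: submodule_setI => //; case: (uP i).
  + by split; [case: (uP i) => _ /(_ m Km) | exact: KX].
  + exact: subIsetr.
  + by case: (u_lt i).
  by have [_ []] := u_lt n; rewrite (nP n.+1).
- split=> //; first exact: submodule_setT.
  move=> u _ Tu _ _; exists 0%N => m _.
  by apply/seteqP; split=> // x _; exact: Tu.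
exists N; split=> // t [Nt Xt]; apply: contrapT => nKt.
have [L Lmax KL] := exists_maximal_avoiding hK nKt.
have [hL nLt _] := Lmax.
apply: (N_min (N `&` L)); split.
- exact: submodule_setI.
- by move=> m Km; split; [exact: KN | exact: KL].
- by apply: dcc_setI => //; exact: dcc_maximal_avoiding Lmax R_noeth.
- by move=> m [[Nm _] Xm].
- by move=> /(_ t (conj Nt Xt)) [[_ /nLt]].
Qed.

End NoetherianRing.

(** * Extensions of artinian modules by a Serre subcategory *)

Section SerreSubcategory.
Variables (R : pzRingType) (S : subcategory R).
Hypothesis hS : serre_subcategory S.

(** Membership in [S] is tested on some module isomorphic to [K]; for a Serre
    subcategory the choice does not matter. *)
Definition submodule_in (M : lmodType R) (K : set M) : Prop :=
  exists (A : lmodType R) (f : {linear A -> M}),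
    [/\ injective f, range f = K & S A].

Lemma submodule_in_submodule (M : lmodType R) (K : set M) :
  submodule_in K -> submodule K.
Proof. by move=> [A [f [_ <- _]]]; exact: submodule_range. Qed.

Lemma submodule_in_set0 (M : lmodType R) : submodule_in [set (0 : M)].
Proof.
have [A [f [f_inj fA]]] := exists_submodule_object (submodule_set0 M).
exists A, f; split=> //; apply: (serre_zero hS) => x; apply: f_inj.
have : range f (f x) by exists x.
by rewrite fA linear0.
Qed.

Lemma submodule_in_image (M M' : lmodType R) (h : {linear M -> M'}) (K : set M) :
  submodule_in K -> submodule_in (h @` K).
Proof.
move=> KS; have hK := submodule_in_submodule KS.
have [A [f [f_inj fA SA]]] := KS.
have [B [k [k_inj kB]]] := exists_submodule_object (submodule_image h hK).
have [|v vE] := @linear_factor _ A B M' (h \o f) k k_inj.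
  by rewrite kB -fA => _ [a _ <-]; exists (f a) => //; exists a.
exists B, k; split=> //; apply: (serre_quotient hS (g := v)) SA => b.
have : range k (k b) by exists b.
rewrite kB -fA => -[_ [a _ <-] hfa].
by exists a; apply: k_inj; rewrite vE.
Qed.

(** [K] is an extension of its image under [h], a submodule of [K'], by its
    intersection with the kernel of [h]. *)
Lemma submodule_in_extension (M M' : lmodType R) (h : {linear M -> M'})
    (K : set M) (K' : set M') :
  submodule K -> submodule_in (K `&` h @^-1` [set 0]) -> submodule_in K' ->
  h @` K `<=` K' -> submodule_in K.
Proof.
move=> hK [C [c [c_inj cC SC]]] [A' [f' [f'_inj f'A' SA']]] hKK'.
have [A [f [f_inj fA]]] := exists_submodule_object hK.
have [I [k [k_inj kI]]] := exists_submodule_object (submodule_image h hK).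
have [|u uE] := @linear_factor _ C A M c f f_inj.
  by rewrite fA cC; exact: subIsetl.
have [|v vE] := @linear_factor _ A I M' (h \o f) k k_inj.
  by rewrite kI -fA => _ [a _ <-]; exists (f a) => //; exists a.
have [|w wE] := @linear_factor _ I A' M' k f' f'_inj.
  by rewrite kI f'A'.
have SI : S I.
  by apply: (serre_sub hS (f := w)) SA' => x y wxy; apply: k_inj; rewrite -!wE wxy.
exists A, f; split=> //; apply: (serre_extension hS (f := u) (g := v)) SC SI.
split.
- by move=> x y uxy; apply: c_inj; rewrite -!uE uxy.
- move=> a; split=> [va0 | [x <-]].
    have : (K `&` h @^-1` [set 0]) (f a).
      split; first by rewrite -fA; exists a.
      by rewrite /= -[h (f a)]/((h \o f) a) -vE va0 linear0.
    by rewrite -cC => -[x _ cx]; exists x; apply: f_inj; rewrite uE.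
  apply: k_inj; rewrite vE linear0 /= uE.
  have : range c (c x) by exists x.
  by rewrite cC => -[].
- move=> i; have : range k (k i) by exists i.
  rewrite kI -fA => -[_ [a _ <-] hfa].
  by exists a; apply: k_inj; rewrite vE.
Qed.

Lemma extension_artinianP (M : lmodType R) :
  extension_subcategory S (@artinian_subcategory R) M <->
  exists2 K : set M, submodule_in K & dcc_interval K setT.
Proof.
split=> [[A [B [f [g [[f_inj ker_g g_surj] SA artB]]]]] | [K KS dccK]].
  exists (range f); first by exists A, f.
  suff -> : range f = g @^-1` [set 0].
    by apply: dcc_preimage; [exact: submodule_set0 | exact: artinian_dcc].
  apply/seteqP; split=> [_ [a _ <-] | y /= /ker_g[a <-]]; last by exists a.
  by apply/ker_g; exists a.
have [A [f [f_inj fA SA]]] := KS.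
have [B [g [g_surj ker_g]]] :=
  exists_quotient_object (submodule_in_submodule KS).
exists A, B, f, g; split=> //.
  split=> // y; split=> [/ker_g | [a <-]].
    by rewrite -fA => -[a _ <-]; exists a.
  by apply/ker_g; rewrite -fA; exists a.
apply: dcc_artinian.
have <- : g @` K = [set 0].
  apply/seteqP; split=> [_ [y /ker_g gy0 <-] // | _ ->].
  exists 0; last exact: linear0.
  by apply/ker_g; rewrite linear0.
have <- : range g = setT.
  by apply/seteqP; split=> // z _; have [y <-] := g_surj z; exists y.
exact: dcc_image.
Qed.

End SerreSubcategory.

Section ExtensionSubcategory.
Variables (R : comPzRingType) (S : subcategory R).
Hypothesis hS : serre_subcategory S.
Local Notation E := (extension_subcategory S (@artinian_subcategory R)).

Lemma extension_artinian_zero (M : lmodType R) : (forall x : M, x = 0) -> E M.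
Proof.
move=> M0; apply/extension_artinianP; exists [set 0].
  exact: submodule_in_set0.
move=> u _ Ku _ _; exists 0%N => m _.
by apply/seteqP; split=> x _; apply: Ku; exact: M0.
Qed.

Lemma extension_artinian_sub (N M : lmodType R) (f : {linear N -> M}) :
  injective f -> E M -> E N.
Proof.
move=> f_inj /extension_artinianP[K KS dccK].
have hK := submodule_in_submodule KS.
apply/extension_artinianP; exists (f @^-1` K); last exact: dcc_preimage.
apply: (submodule_in_extension hS (h := f) _ _ KS).
- exact: submodule_preimage.
- suff -> : f @^-1` K `&` f @^-1` [set 0] = [set 0] by exact: submodule_in_set0.
  apply/seteqP; split=> [x [_ fx0] | _ ->].
    by apply: f_inj; rewrite linear0.
  by split; rewrite /= linear0 //; exact: submodule0.
- exact: image_preimage_subset.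
Qed.

Lemma extension_artinian_quotient (M N : lmodType R) (g : {linear M -> N}) :
  (forall z, exists y, g y = z) -> E M -> E N.
Proof.
move=> g_surj /extension_artinianP[K KS dccK].
apply/extension_artinianP; exists (g @` K).
  exact: submodule_in_image.
have <- : range g = setT.
  by apply/seteqP; split=> // z _; have [y <-] := g_surj z; exists y.
exact: dcc_image.
Qed.

(** The submodule of [Y] is the intersection of the preimage of [KZ] with the
    complement [N] given by [dcc_complement] for the image of [KX] and the
    range of [f]. *)
Lemma extension_artinian_extension (X Y Z : lmodType R)
    (f : {linear X -> Y}) (g : {linear Y -> Z}) :
  noetherian_ring R -> short_exact f g -> E X -> E Z -> E Y.
Proof.
move=> R_noeth [f_inj ker_g g_surj].
move=> /extension_artinianP[KX KXS dccX].
move=> /extension_artinianP[KZ KZS dccZ].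
have hKZ := submodule_in_submodule KZS.
have fKXS := submodule_in_image hS f KXS.
have [|N [hN KN NX dccN]] := dcc_complement R_noeth
  (submodule_in_submodule fKXS) (submodule_range f) _ (dcc_image (h := f) dccX).
  exact: image_subset.
have hP := submodule_preimage g hKZ.
have gf x : g (f x) = 0 by apply/ker_g; exists x.
apply/extension_artinianP; exists (N `&` g @^-1` KZ); last first.
  by apply: dcc_setI => //; exact: dcc_preimage.
apply: (submodule_in_extension hS (h := g) _ _ KZS).
- exact: submodule_setI.
- suff <- : f @` KX = N `&` g @^-1` KZ `&` g @^-1` [set 0] by [].
  apply/seteqP; split=> [_ [x Kx <-] | y [[Ny _] /ker_g[x fx]]].
    split; last exact: gf.
    by split; [apply: KN; exists x | rewrite /= gf; exact: submodule0].
  by apply: NX; split=> //; exists x.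
- by move=> _ [y [_ KZy] <-].
Qed.

End ExtensionSubcategory.

Theorem mainTheorem4 (R : comPzRingType) (S : subcategory R) :
  noetherian_ring R -> serre_subcategory S ->
  serre_subcategory (extension_subcategory S (@artinian_subcategory R)).
Proof.
move=> R_noeth hS; split.
- move=> M N f [f' _ fK]; apply: extension_artinian_quotient => // z.
  by exists (f' z).
- exact: extension_artinian_zero.
- exact: extension_artinian_sub.
- exact: extension_artinian_quotient.
- by move=> A B C f g; exact: extension_artinian_extension.
Qed.
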